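(* Let $\Delta=\Delta(m)$ be a function of the positive integer $m$ with $\Delta(m)\to\infty$ as $m\to\infty$, and let $S$ be any integer. Then the set $$\Big\{qy\pmod m:\ 1\le q\le m^{1/2},\ q \text{ prime},\ S+1\le y\le S+\Delta\, m^{1/2}\sqrt{m/\phi(m)}\,\log m\Big\}$$ (with $y$ an integer) contains $(1+O(\Delta^{-1}))\,m$ residue classes modulo $m$.
   Context: $\phi$ is Euler's totient function. The statement is asymptotic as $m\to\infty$ (i.e. for all sufficiently large $m$), and the constant implied by $O$ is uniform in $m$ and $S$ ($S$ may depend on $m$). *)

(* Defs.v *)
From HB Require Import structures.
From mathcomp Require Import all_boot all_order all_algebra.
From mathcomp Require Import all_classical all_reals all_analysis.
Import Order.TTheory GRing.Theory Num.Theory.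
Import numFieldNormedType.Exports.
Set Implicit Arguments.
Unset Strict Implicit.
Unset Printing Implicit Defensive.
Local Open Scope ring_scope.

Definition interval_length (R : realType) (delta : R) (m : nat) : R :=
  delta * Num.sqrt m%:R * Num.sqrt (m%:R / (totient m)%:R) * ln m%:R.

(* The residue classes modulo m are represented by 'I_m, i.e. by their
   representatives 0, ..., m - 1. *)
Definition prime_mul_residues (R : realType) (m : nat) (S : int) (Y : R) :
    {set 'I_m} :=
  [set r : 'I_m | `[< exists (q : nat) (y : int),
     [/\ (1 <= q)%N, q%:R <= Num.sqrt m%:R :> R & prime q] /\
     [/\ S + 1 <= y, y%:~R <= S%:~R + Y &
         (q%:Z * y = (r : nat)%:Z %[mod m%:Z])%Z] >]].

(* Main.v *)
Require Import Defs.
From HB Require Import structures.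
From mathcomp Require Import all_boot all_order all_algebra.
From mathcomp Require Import all_classical all_reals all_analysis.
From mathcomp Require Import zify ring lra.
Import Order.TTheory GRing.Theory Num.Theory.
Import numFieldNormedType.Exports.
Set Implicit Arguments.
Unset Strict Implicit.
Unset Printing Implicit Defensive.

(* Second moment method.  Let Q be the set of primes q <= sqrt m not dividing m,
   let N be the integer part of the length of the interval, and let r(a) be the
   number of pairs (q, y) with q in Q and q y = a mod m.  By Cauchy-Schwarz, with
   E the number of missed classes,
   (|Q| N)^2 = (sum_a r(a))^2 <= (m - E) sum_a r(a)^2,
   and sum_a r(a)^2 counts the solutions of q y = q' y' mod m.  For distinct
   primes q, q' <= sqrt m there are at most N^2/m + 3N/max(q, q') + 2 of them:
   each value of (q y - q' y')/m and each block of q' consecutive values of y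
   determine at most one solution, and we may take q < q'.  The sum of
   1/max(q, q') over all pairs is at most 2|Q|, whence
   E <= m^2 (7/(|Q| N) + 2/N^2).  Chebyshev's bound |Q| >> sqrt m / log m,
   from 2^n <= 'C(2n, n) <= (2n)^pi(2n), makes this O(m / Delta). *)

Local Open Scope nat_scope.

(** * Cauchy-Schwarz for the fibres of a map *)

Lemma sqr_sum_leq (I : finType) (B : {set I}) (F : I -> nat) :
  (\sum_(b in B) F b) ^ 2 <= #|B| * \sum_(b in B) F b ^ 2.
Proof.
rewrite -(leq_pmul2l (isT : 0 < 2)).
have -> : 2 * (\sum_(b in B) F b) ^ 2 =
    \sum_(a in B) \sum_(b in B) 2 * (F a * F b).
  rewrite -mulnn big_distrlr /= big_distrr /=.
  by apply: eq_bigr => a _; rewrite big_distrr.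
have -> : 2 * (#|B| * \sum_(b in B) F b ^ 2) =
    \sum_(a in B) \sum_(b in B) (F a ^ 2 + F b ^ 2).
  under [RHS]eq_bigr do rewrite big_split /= sum_nat_const.
  by rewrite big_split /= sum_nat_const -big_distrr /=; lia.
by apply: leq_sum => a _; apply: leq_sum => b _; apply: nat_Cauchy.
Qed.

(** Cauchy-Schwarz over the fibres of [f]: the fibre sizes add up to [#|A|], and their squares add
    up to the number of colliding pairs. *)
Lemma sqr_card_leq_imset (T U : finType) (f : T -> U) (A : {set T}) :
  #|A| ^ 2 <= #|f @: A| * \sum_(x in A) \sum_(y in A) (f x == f y).
Proof.
have sumF (F : U -> nat) :
    \sum_(x in A) F (f x) = \sum_(b in f @: A) \sum_(x in A | f x == b) F b.
  rewrite (partition_big_imset f) /=; apply: eq_bigr => b _.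
  by apply: eq_bigr => x /andP[_ /eqP->].
have -> : \sum_(x in A) \sum_(y in A) (f x == f y) =
    \sum_(b in f @: A) (\sum_(x in A | f x == b) 1) ^ 2.
  rewrite (sumF (fun b => \sum_(y in A) (b == f y : nat))).
  apply: eq_bigr => b _; rewrite -mulnn big_distrl /=.
  apply: eq_bigr => x _; rewrite mul1n big_mkcondr /=.
  by apply: eq_bigr => y _; rewrite eq_sym; case: eqP.
by rewrite -sum1_card (sumF (fun=> 1)); apply: sqr_sum_leq.
Qed.

(** * Counting solutions of q y = r y' modulo m *)

Lemma modn_div_inj (d x y : nat) : x %/ d = y %/ d -> x = y %[mod d] -> x = y.
Proof. by move=> e1 e2; rewrite (divn_eq x d) (divn_eq y d) e1 e2. Qed.

Lemma sum_nat_of_bool2 (I J : finType) (P : I -> J -> bool) :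
  \sum_i \sum_j (P i j : nat) = #|[pred p | P p.1 p.2]|.
Proof.
rewrite pair_bigA -sum1_card [RHS]big_mkcond /=.
by apply: eq_bigr => p _; rewrite inE; case: (P _ _).
Qed.

(** The pair (block of [u], quotient of [w u v] by [m]) determines a solution. Within a block the
    residue of [w] modulo [m] is fixed, so the quotient gives [w]; then [w] modulo [r] gives [u],
    and [v] follows. *)
Lemma offdiag_collisions (m N s q r : nat) : 0 < r -> coprime q r ->
  \sum_(u < N) \sum_(v < N) (q * (s + u) == r * (s + v) %[mod m]) <=
  (N %/ r).+1 * ((r * N + q * r) %/ m).+1.
Proof.
move=> r0 cqr.
rewrite sum_nat_of_bool2; set D := [pred p | _].
pose b (u : 'I_N) : 'I_(N %/ r).+1 := inord (u %/ r).
(* Up to a constant on each block of r values of u, w u v is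
   q (s + u) - r (s + v), shifted so as to be a natural number. *)
pose w (u v : 'I_N) := q * (u %% r) + r * (N.-1 - v).
pose k (u v : 'I_N) : 'I_((r * N + q * r) %/ m).+1 := inord (w u v %/ m).
have bE u : b u = u %/ r :> nat.
  by rewrite inordK // ltnS leq_div2r // ltnW.
have kE u v : k u v = w u v %/ m :> nat.
  rewrite inordK // ltnS leq_div2r // /w addnC leq_add //.
    by rewrite leq_mul2l; apply/orP; right; lia.
  by rewrite leq_mul2l ltnW ?orbT // ltn_mod.
(* On solutions, [w] is congruent modulo [m] to a constant minus a term that depends only on the
   block [u %/ r]. *)
have wE u v : (u, v) \in D ->
    w u v + q * (s + u %/ r * r) = r * (N.-1 + s) %[mod m].
  rewrite inE /= => /eqP e.
  have -> : w u v + q * (s + u %/ r * r) = q * (s + u) + r * (N.-1 - v).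
    by rewrite [in RHS](divn_eq u r) /w; lia.
  rewrite -modnDml e modnDml -mulnDr; congr (_ * _ %% _).
  by have := ltn_ord v; lia.
pose g (p : 'I_N * 'I_N) := (b p.1, k p.1 p.2).
have ginj : {in D &, injective g}.
  move=> [u v] [u' v'] Duv Duv' [/(congr1 val) /= eb /(congr1 val) /= ek].
  rewrite !bE in eb; rewrite !kE in ek.
  have ew : w u v = w u' v'.
    apply: (modn_div_inj ek); apply/eqP.
    rewrite -(eqn_modDr (q * (s + u %/ r * r))) {2}eb.
    by apply/eqP; rewrite !wE.
  (* Modulo [r] only [q * (u %% r)] survives in [w], and [q] is invertible there. *)
  have eu : u %% r = u' %% r.
    have : q * (u %% r) == q * (u' %% r) %[mod r].
      have := congr1 (modn^~ r) ew.
      rewrite /w /= ![_ + r * _]addnC -(modnDml (r * _)).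
      by rewrite -[in RHS](modnDml (r * _)) !modnMr !add0n => ->.
    wlog le_u : u u' {v v' Duv Duv' eb ek ew} / u' %% r <= u %% r.
      move=> H; case: (leqP (u' %% r) (u %% r)) => [/H//|/ltnW/H{}H].
      by rewrite eq_sym => /H.
    rewrite eqn_mod_dvd ?leq_mul2l ?le_u ?orbT // -mulnBr Gauss_dvdr; last first.
      by rewrite coprime_sym.
    by rewrite -eqn_mod_dvd // !modn_mod => /eqP.
  have /val_inj eu' : val u = val u'.
    by rewrite /= (divn_eq u r) (divn_eq u' r) eb eu.
  have /val_inj ev' : val v = val v'.
    move: ew; rewrite /w eu => /addnI /eqP; rewrite eqn_pmul2l // => /eqP.
    by have := ltn_ord v; have := ltn_ord v'; rewrite /=; lia.
  by rewrite eu' ev'.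
rewrite -(card_in_imset ginj) (leq_trans (max_card _)) //.
by rewrite card_prod !card_ord.
Qed.

(** As [q] is invertible modulo [m], a solution has [u] and [v] congruent, so each [u] admits at
    most one [v] in each block of length [m]. *)
Lemma diag_collisions (m N s q : nat) : coprime q m ->
  \sum_(u < N) \sum_(v < N) (q * (s + u) == q * (s + v) %[mod m]) <=
  N * (N %/ m).+1.
Proof.
move=> cqm.
rewrite sum_nat_of_bool2; set D := [pred p | _].
pose b (u : 'I_N) : 'I_(N %/ m).+1 := inord (u %/ m).
have bE u : b u = u %/ m :> nat.
  by rewrite inordK // ltnS leq_div2r // ltnW.
have DE u v : (u, v) \in D -> u = v %[mod m].
  rewrite inE /=; wlog le_u : u v / v <= u.
    move=> H; case: (leqP v u) => [/H//|/ltnW/H{}H].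
    by rewrite eq_sym => /H.
  rewrite eqn_mod_dvd ?leq_mul2l ?leq_add2l ?le_u ?orbT //.
  rewrite -mulnBr subnDl Gauss_dvdr; last by rewrite coprime_sym.
  by rewrite -eqn_mod_dvd // => /eqP.
pose g (p : 'I_N * 'I_N) := (p.1, b p.2).
have ginj : {in D &, injective g}.
  move=> [u v] [u' v'] /DE Duv /DE Duv' [eu /(congr1 val) /= eb].
  subst u'; congr (_, _); apply/val_inj/(@modn_div_inj m); rewrite -?bE ?eb //.
  by rewrite -Duv -Duv'.
rewrite -(card_in_imset ginj) (leq_trans (max_card _)) //.
by rewrite card_prod !card_ord.
Qed.

(** * Chebyshev's argument with central binomial coefficients *)

(** Pascal's rule splits the next central coefficient into two terms, each at least the current
    one. *)
Lemma exp2_leq_central_bin n : 2 ^ n <= 'C(n.*2, n).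
Proof.
elim: n => // n IHn; rewrite expnS doubleS binS mul2n -addnn leq_add //.
  by rewrite (leq_trans IHn) // binS leq_addl.
by rewrite (leq_trans IHn) // leq_bin2l.
Qed.

(** Legendre's formula with a free cut-off, the terms beyond it being zero. This lets n! and (2n)!
    be expanded over the same range of exponents. *)
Lemma logn_fact_trunc p n b : prime p -> n < p ^ b ->
  logn p n`! = \sum_(1 <= k < b) n %/ p ^ k.
Proof.
move=> pp; have p1 := prime_gt1 pp.
have widen a c : 0 < a <= c -> n < p ^ a ->
    \sum_(1 <= k < a) n %/ p ^ k = \sum_(1 <= k < c) n %/ p ^ k.
  move=> /andP[a0 ac] na; rewrite [RHS](big_cat_nat (n := a)) //=.
  rewrite [X in _ + X]big_nat_cond [X in _ + X]big1 ?addn0 // => k.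
  by case/andP=> /andP[ak _] _; rewrite divn_small // (leq_trans na) ?leq_exp2l.
have nn : n < p ^ n.+1 by rewrite (ltn_trans (ltn_expl n p1)) // ltn_exp2l.
rewrite logn_fact //; case: b => [|b] nb.
  by move: nb; rewrite expn0 ltnS leqn0 => /eqP ->; rewrite !big_geq.
by case: (leqP b n) => bn; [rewrite (widen b.+1 n.+1)|rewrite (widen n.+1 b.+1)]
  => //; lia.
Qed.

(** By Legendre's formula the exponent is a sum of [trunc_log p n.*2] differences floor(2n/p^k) - 2
    floor(n/p^k), each at most 1. *)
Lemma pfactor_central_bin_leq n p : 0 < n -> prime p ->
  p ^ logn p 'C(n.*2, n) <= n.*2.
Proof.
move=> n0 pp; have p1 := prime_gt1 pp.
have n20 : 0 < n.*2 by rewrite double_gt0.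
suff le_log : logn p 'C(n.*2, n) <= trunc_log p n.*2.
  by rewrite (leq_trans _ (trunc_logP p1 n20)) // leq_exp2l.
have nn : n <= n.*2 by rewrite -addnn leq_addr.
have C0 : 0 < 'C(n.*2, n) by rewrite bin_gt0.
have := congr1 (logn p) (bin_fact nn).
have -> : n.*2 - n = n by rewrite -addnn addnK.
have n2lt : n.*2 < p ^ (trunc_log p n.*2).+1 by rewrite trunc_log_ltn.
rewrite !lognM ?muln_gt0 ?fact_gt0 //.
rewrite !(logn_fact_trunc (b := (trunc_log p n.*2).+1)) ?(leq_ltn_trans nn) //.
set t := trunc_log p _ => facE.
have : \sum_(1 <= k < t.+1) n.*2 %/ p ^ k <=
    \sum_(1 <= k < t.+1) (n %/ p ^ k + n %/ p ^ k + 1).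
  by apply: leq_sum => k _; rewrite -addnn leq_divDl.
rewrite !big_split /= sum_nat_const_nat -facE addnC leq_add2l.
by rewrite muln1 subn1.
Qed.

(** Each prime power in the factorization is at least 2. This limits how many primes are lost by
    requiring coprimality to [m]. *)
Lemma exp2_size_primes_leq m : 0 < m -> 2 ^ size (primes m) <= m.
Proof.
move=> m0; rewrite {2}(prod_prime_decomp m0) prime_decompE big_map /=.
rewrite -sum1_size expn_sum !big_seq.
apply: leq_prod => p; rewrite expn1 => pm.
have p1 : 1 < p by move: pm; rewrite mem_primes => /andP[/prime_gt1].
by rewrite (leq_trans p1) // -{1}(expn1 p) leq_exp2l // logn_gt0.
Qed.

Lemma central_bin_leq n : 0 < n ->
  'C(n.*2, n) <= n.*2 ^ size (primes 'C(n.*2, n)).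
Proof.
move=> n0.
have C0 : 0 < 'C(n.*2, n) by rewrite bin_gt0 -addnn leq_addr.
rewrite {1}(prod_prime_decomp C0) prime_decompE big_map /=.
rewrite -sum1_size expn_sum !big_seq.
apply: leq_prod => p; rewrite mem_primes expn1 => /andP[pp _].
exact: pfactor_central_bin_leq.
Qed.

(** The set Q of the second moment argument; q <= sqrt m is expressed by squaring, inside the
    natural numbers. *)
Definition unit_primes (m : nat) : {set 'I_m.+1} :=
  [set q : 'I_m.+1 | [&& prime q, coprime q m & q ^ 2 <= m]].

(** A prime factor of the binomial coefficient is at most 2n, by the bound on its prime powers,
    hence at most sqrt m. It either divides [m] or lies in [unit_primes m]. *)
Lemma size_primes_central_bin_leq m n : 0 < n -> n.*2 ^ 2 <= m ->
  size (primes 'C(n.*2, n)) <= #|unit_primes m| + size (primes m).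
Proof.
move=> n0 nm; have C0 : 0 < 'C(n.*2, n) by rewrite bin_gt0 -addnn leq_addr.
rewrite cardE -(size_map val) -size_cat uniq_leq_size ?primes_uniq // => p.
rewrite mem_cat => pC; have := pC; rewrite !mem_primes C0 /= => /andP[pp pdvd].
have p2n : p <= n.*2.
  apply: leq_trans (pfactor_central_bin_leq n0 pp).
  by rewrite -{1}(expn1 p) leq_exp2l ?prime_gt1 // logn_gt0.
have p2m : p ^ 2 <= m by rewrite (leq_trans _ nm) // leq_exp2r.
have pm : p < m.+1.
  by rewrite ltnS (leq_trans _ p2m) // -{1}(expn1 p) leq_exp2l ?prime_gt1.
have m0 : 0 < m by rewrite (leq_trans _ p2m) // expn_gt0 prime_gt0.
have [pdm | npdm] := boolP (p %| m); first by rewrite pp m0 orbT.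
apply/orP; left; apply/mapP; exists (Ordinal pm) => //.
by rewrite mem_enum inE /= pp p2m prime_coprime // npdm.
Qed.

Local Open Scope classical_set_scope.
Local Open Scope ring_scope.

(** * The second moment bound for the number of missed classes *)

Lemma natr_divn_le (R : realFieldType) (a d : nat) :
  (a %/ d)%:R <= a%:R / d%:R :> R.
Proof.
have [->|d0] := posnP d; first by rewrite divn0 invr0 mulr0.
by rewrite ler_pdivlMr ?ltr0n // -natrM ler_nat leq_trunc_div.
Qed.

(** Since qr <= r^2 <= m, the count is at most (N/r + 1)(rN/m + 2). Upon expansion the cross term
    rN/m is at most N/r, which turns 2N/r into 3N/r. *)
Lemma offdiag_collisions_real (R : realFieldType) (m N s q r : nat) :
    (0 < q <= r)%N -> coprime q r -> (r ^ 2 <= m)%N ->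
  (\sum_(u < N) \sum_(v < N) (q * (s + u) == r * (s + v) %[mod m]))%N%:R <=
  N%:R ^+ 2 / m%:R + 3 * N%:R / r%:R + 2 :> R.
Proof.
move=> /andP[q0 qr] cqr rm; have r0 : (0 < r)%N by apply: leq_trans qr.
have m0 : (0 < m)%N by apply: leq_trans rm; rewrite expn_gt0 r0.
have rR : 0 < r%:R :> R by rewrite ltr0n.
have mR : 0 < m%:R :> R by rewrite ltr0n.
have NR : 0 <= N%:R :> R by rewrite ler0n.
apply: (@le_trans _ _ (((N %/ r).+1 * ((r * N + q * r) %/ m).+1)%N%:R)).
  by rewrite ler_nat offdiag_collisions.
rewrite natrM.
have h1 : (N %/ r).+1%:R <= N%:R / r%:R + 1 :> R.
  by rewrite -natr1 lerD2r natr_divn_le.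
have h2 : ((r * N + q * r) %/ m).+1%:R <= r%:R * N%:R / m%:R + 2 :> R.
  rewrite -natr1; apply: (@le_trans _ _ ((r * N + q * r)%:R / m%:R + 1)).
    by rewrite lerD2r natr_divn_le.
  rewrite natrD mulrDl natrM -addrA lerD2l -[2]/(1 + 1) lerD2r.
  rewrite ler_pdivrMr // mul1r ler_nat (leq_trans _ rm) //.
  by rewrite -mulnn leq_mul2r qr orbT.
apply: (le_trans (ler_pM (ler0n _ _) (ler0n _ _) h1 h2)).
have h3 : r%:R * N%:R / m%:R <= N%:R / r%:R :> R.
  rewrite ler_pdivrMr // mulrAC ler_pdivlMr //.
  rewrite mulrAC mulrC ler_wpM2l // -natrM ler_nat.
  by rewrite mulnn.
have -> : (N%:R / r%:R + 1) * (r%:R * N%:R / m%:R + 2) =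
    N%:R ^+ 2 / m%:R + 2 * N%:R / r%:R + r%:R * N%:R / m%:R + 2 :> R.
  by field; rewrite !gt_eqF.
rewrite -![_ * N%:R / r%:R]mulrA; move: h3.
by set x := r%:R * _ / _; set y := N%:R / _; lra.
Qed.

Lemma collisions_leq (R : realFieldType) (m N s : nat) (Q : {set 'I_m.+1}) :
    (0 < m)%N -> Q \subset unit_primes m ->
  (\sum_(q in Q) \sum_(r in Q) \sum_(u < N) \sum_(v < N)
     ((q : nat) * (s + u) == r * (s + v) %[mod m]))%N%:R <=
  (#|Q|%:R * N%:R) ^+ 2 / m%:R + 7 * #|Q|%:R * N%:R + 2 * #|Q|%:R ^+ 2 :> R.
Proof.
move=> m0 /fintype.subsetP subQ.
have QP (q : 'I_m.+1) : q \in Q -> [/\ prime q, coprime q m & (q ^ 2 <= m)%N].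
  by move=> /subQ; rewrite inE => /and3P.
have mR : 0 < m%:R :> R by rewrite ltr0n.
have NR : 0 <= N%:R :> R by rewrite ler0n.
have inv0 (r : nat) : 0 <= r%:R^-1 :> R by rewrite invr_ge0.
(* For distinct q and r, [h q r + h r q] is 1/max(q, r). In the sum of [h], each r meets at most r
   values q <= r and so contributes at most 1. *)
pose h (q r : 'I_m.+1) : R := if (q <= r)%N then r%:R^-1 else 0.
have h0 q r : 0 <= h q r by rewrite /h; case: ifP.
have sumh : \sum_(q in Q) \sum_(r in Q) h q r <= #|Q|%:R.
  rewrite exchange_big /= -sum1_card natr_sum; apply: ler_sum => r rQ.
  have [rp _ _] := QP _ rQ; have r0 := prime_gt0 rp.
  rewrite -big_mkcondr /= sumr_const -[_ *+ _]mulr_natl.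
  rewrite ler_pdivrMr ?ltr0n // mul1r ler_nat.
  rewrite cardE -(size_map val) -[leqRHS](size_iota 1) uniq_leq_size //.
    by rewrite map_inj_uniq ?enum_uniq //; apply: val_inj.
  move=> x /mapP[q]; rewrite mem_enum => /andP[/QP[qp _ _] qr] -> /=.
  by rewrite mem_iota prime_gt0 // add1n ltnS.
have pt (q r : 'I_m.+1) : q \in Q -> r \in Q ->
    (\sum_(u < N) \sum_(v < N)
       ((q : nat) * (s + u) == r * (s + v) %[mod m]))%N%:R
    <= N%:R ^+ 2 / m%:R + 2 + (if q == r then N%:R else 0)
       + 3 * N%:R * (h q r + h r q).
  move=> /QP[qp qm q2] /QP[rp rm r2].
  case: eqP => [<-|/eqP neq].
    apply: (@le_trans _ _ (N * (N %/ m).+1)%N%:R).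
      by rewrite ler_nat diag_collisions.
    have := mulr_ge0 NR (h0 q q).
    have : N%:R * (N %/ m)%:R <= N%:R ^+ 2 / m%:R :> R.
      by rewrite expr2 -mulrA ler_wpM2l // natr_divn_le.
    rewrite natrM -natr1; set x := _ / _; set y := _%:R; nra.
  have cqr : coprime q r by rewrite prime_coprime // dvdn_prime2.
  have q0 := prime_gt0 qp; have r0 := prime_gt0 rp.
  have hN := mulr_ge0 NR (h0 _ _).
  case: (leqP q r) => qr.
    have := @offdiag_collisions_real R m N s q r.
    rewrite q0 qr => /(_ isT cqr r2) /le_trans; apply.
    have := hN r q; rewrite [h q r]/h qr; set x := _ / m%:R; nra.
  (* For r < q, exchange the two sides of the congruence. *)
  have := @offdiag_collisions_real R m N s r q.
  rewrite r0 ltnW // coprime_sym => /(_ isT cqr q2) le1.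
  rewrite exchange_big /=; under eq_bigr do under eq_bigr do rewrite eq_sym.
  apply: (le_trans le1).
  have := hN q r; rewrite [h r q]/h ltnW //; set x := _ / m%:R; nra.
rewrite natr_sum.
apply: (@le_trans _ _ (\sum_(q in Q) \sum_(r in Q) (N%:R ^+ 2 / m%:R + 2
    + (if q == r then N%:R else 0) + 3 * N%:R * (h q r + h r q)))).
  apply: ler_sum => q qQ; rewrite natr_sum; apply: ler_sum => r rQ.
  exact: pt.
have splitE (A K : R) (F : 'I_m.+1 -> 'I_m.+1 -> R) :
    \sum_(q in Q) \sum_(r in Q) (A + F q r + K * (h q r + h r q)) =
    #|Q|%:R ^+ 2 * A + \sum_(q in Q) \sum_(r in Q) F q r
    + 2 * K * \sum_(q in Q) \sum_(r in Q) h q r.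
  have -> : 2 * K * \sum_(q in Q) \sum_(r in Q) h q r =
      \sum_(q in Q) \sum_(r in Q) K * (h q r + h r q).
    under [RHS]eq_bigr do rewrite -mulr_sumr big_split.
    rewrite -mulr_sumr big_split /= [X in _ = K * (_ + X)]exchange_big /=.
    by ring.
  have -> : #|Q|%:R ^+ 2 * A = \sum_(q in Q) \sum_(r in Q) A.
    by rewrite !sumr_const -mulrnA -[RHS]mulr_natl natrM expr2.
  by rewrite -!big_split /=; apply: eq_bigr => q _; rewrite -!big_split.
rewrite splitE.
have -> : \sum_(q in Q) \sum_(r in Q) (if q == r then N%:R else 0) =
    #|Q|%:R * N%:R :> R.
  rewrite mulr_natl -sumr_const; apply: eq_bigr => q qQ.
  rewrite (bigD1 q) //= eqxx big1 ?addr0 // => r /andP[_ /negPf].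
  by rewrite eq_sym => ->.
have := ler_wpM2l NR sumh; set H := \sum_(q in Q) _ => le_H.
have -> : (#|Q|%:R * N%:R) ^+ 2 / m%:R =
  #|Q|%:R ^+ 2 * (N%:R ^+ 2 / m%:R) :> R by rewrite exprMn mulrA.
(* The 7 is 1 from the diagonal plus 2 * 3 from the two copies of the sum of [h]. *)
rewrite mulrDr -!addrA lerD2l; lra.
Qed.

(** [V] bounds the excess of the second moment over its equidistributed value A^2/M. Multiplying A^2
    <= P (A^2/M + V) by M gives A^2 (M - P) <= P V M <= M^2 V. *)
Lemma second_moment_deficit (R : realFieldType) (A M V W P : R) :
    0 < A -> 0 < M -> 0 <= V -> A ^+ 2 <= P * W -> W <= A ^+ 2 / M + V ->
    P <= M -> 0 <= P ->
  M - P <= M ^+ 2 * V / A ^+ 2.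
Proof.
move=> A0 M0 V0 le_PW le_W PM P0.
rewrite ler_pdivlMr ?exprn_gt0 //.
have h : A ^+ 2 <= P * (A ^+ 2 / M + V).
  by apply: le_trans le_PW _; rewrite ler_wpM2l.
have {}h : A ^+ 2 * M <= P * (A ^+ 2 + V * M).
  have := ler_wpM2r (ltW M0) h.
  by rewrite -[P * _ * M]mulrA [(_ + V) * M]mulrDl divfK ?gt_eqF.
have h2 : P * (V * M) <= M * (V * M) by rewrite ler_wpM2r // mulr_ge0 // ltW.
by move: h h2; lra.
Qed.

Lemma missing_residues_le (R : realType) (m N : nat) (S : int) (Y : R) :
    (0 < m)%N -> (0 < N)%N -> (0 < #|unit_primes m|)%N -> N%:R <= Y ->
  m%:R - #|prime_mul_residues m S Y|%:R <=
  m%:R ^+ 2 * (7 / (#|unit_primes m|%:R * N%:R) + 2 / N%:R ^+ 2) :> R.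
Proof.
move=> m0 N0 Q0 NY; set Q := unit_primes m.
(* A natural number congruent to S + 1, so that the collision counts over the natural numbers apply;
   y = S + 1 + u is then represented by [s + u]. *)
pose s := `|((S + 1) %% m%:Z)%Z|%N.
have sE : s%:Z = S + 1 %[mod m%:Z]%Z.
  by rewrite /s gez0_abs ?modz_ge0 ?modz_mod //; lia.
pose f (p : 'I_m.+1 * 'I_N) : 'I_m :=
  Ordinal (ltn_pmod (p.1 * (s + p.2)) m0).
pose A : {set 'I_m.+1 * 'I_N} := finset.setX Q [set: 'I_N]%SET.
have subf : f @: A \subset prime_mul_residues m S Y.
  apply/fintype.subsetP => _ /imsetP[[q u] + ->].
  rewrite !inE /= andbT => /and3P[qp _ q2].

  exists q, (S + 1 + (u : nat)%:Z); split; split => //.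
  - exact: prime_gt0.
  - rewrite -[leLHS]ger0_norm ?ler0n // -sqrtr_sqr ler_wsqrtr //.
    by rewrite -natrX ler_nat.
  - by rewrite lerDl.
  - rewrite -addrA intrD lerD2l; apply: le_trans NY.
    have -> : 1 + (u : nat)%:Z = (u.+1)%:Z by lia.
    by rewrite ler_nat.
  - rewrite /= -modz_nat modz_mod PoszM PoszD.
    by rewrite -modzMmr -modzDml -sE modzDml modzMmr.
have cardA : #|A| = (#|Q| * N)%N by rewrite cardsX cardsT card_ord.
have collE : (\sum_(x in A) \sum_(y in A) (f x == f y) =
    \sum_(q in Q) \sum_(r in Q) \sum_(u < N) \sum_(v < N)
     ((q : nat) * (s + u) == r * (s + v) %[mod m]))%N.
  have sumA (F : 'I_m.+1 * 'I_N -> nat) :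
      (\sum_(x in A) F x = \sum_(q in Q) \sum_(u < N) F (q, u))%N.
    rewrite pair_big /=; apply: eq_big => [[q u]|[q u] _] //=.
    by rewrite !inE andbT.
  rewrite sumA; apply: eq_bigr => q _.
  under [LHS]eq_bigr => u _ do rewrite sumA.
  by rewrite exchange_big.
have := sqr_card_leq_imset f A; rewrite cardA collE.
rewrite -(ler_nat R) natrX !natrM => ineq1.
have ineq2 := @collisions_leq R m N s Q m0 (fintype.subxx _).
have ineq3 : #|f @: A|%:R <= #|prime_mul_residues m S Y|%:R :> R.
  by rewrite ler_nat subset_leq_card.
have ineq4 : #|prime_mul_residues m S Y|%:R <= m%:R :> R.
  by rewrite ler_nat -[leqRHS]card_ord max_card.
have mR : 0 < m%:R :> R by rewrite ltr0n.
have NR : 0 < N%:R :> R by rewrite ltr0n.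
have QR : 0 < #|Q|%:R :> R by rewrite ltr0n.
pose V : R := 7 * #|Q|%:R * N%:R + 2 * #|Q|%:R ^+ 2.
rewrite -addrA -/V in ineq2.
have V0 : 0 <= V by rewrite addr_ge0 ?mulr_ge0 ?exprn_ge0 ?ler0n.
have A0 : 0 < #|Q|%:R * N%:R :> R by rewrite mulr_gt0.
have -> : 7 / (#|Q|%:R * N%:R) + 2 / N%:R ^+ 2 = V / (#|Q|%:R * N%:R) ^+ 2.
  by rewrite /V; field; rewrite !gt_eqF.
rewrite mulrA.
apply: second_moment_deficit (A0) (mR) (V0) _ (ineq2) (ineq4) _ => //.
by apply: le_trans ineq1 _; rewrite ler_wpM2r ?ler0n.
Qed.

(** * Lower bound for the number of usable primes *)

(** With x = m^(1/8), ln m = 8 ln x <= 8x, so the left side is at most 64 |K| x^2, while sqrt m =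
    x^4 and x^2 eventually exceeds 64 |K|. *)
Lemma ln_sqr_le_sqrt (R : realType) (K : R) :
  \forall m \near \oo, K * ln m%:R ^+ 2 <= Num.sqrt m%:R :> R.
Proof.
near=> m; set x : R := Num.sqrt (Num.sqrt (Num.sqrt m%:R)).
have m1 : (0 < m)%N by near: m; exists 1%N.
have x0 : 0 < x by rewrite !sqrtr_gt0 ltr0n.
have x2 : x ^+ 2 = Num.sqrt (Num.sqrt m%:R) by rewrite sqr_sqrtr ?sqrtr_ge0.
have x4 : x ^+ 4 = Num.sqrt m%:R.
  by rewrite (exprM x 2 2) x2 sqr_sqrtr ?sqrtr_ge0.
have x8 : x ^+ 8 = m%:R by rewrite (exprM x 4 2) x4 sqr_sqrtr.
have B_le : 64 * `|K| <= x ^+ 2.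
  have B0 : 0 <= 64 * `|K| by rewrite mulr_ge0.
  have : (64 * `|K|) ^+ 4 <= (x ^+ 2) ^+ 4.
    by rewrite -(exprM x) x8; near: m; exact: nbhs_infty_ger.
  by rewrite ler_pXn2r // ?nnegrE ?exprn_ge0 // ltW.
have ln_le : ln m%:R ^+ 2 <= 64 * x ^+ 2.
  have -> : 64 * x ^+ 2 = (8 * x) ^+ 2 by ring.
  rewrite ler_sqr ?nnegrE ?ln_ge0 ?ler1n ?mulr_ge0 ?(ltW x0) //.
  by rewrite -x8 lnXn // -[ln x *+ 8]mulr_natl ler_wpM2l // ltW // ln_sublinear.
apply: (@le_trans _ _ (`|K| * (64 * x ^+ 2))).
  apply: (@le_trans _ _ (`|K| * ln m%:R ^+ 2)); last by rewrite ler_wpM2l.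
  by rewrite ler_wpM2r ?ler_norm ?sqr_ge0.
rewrite mulrA [`|K| * _]mulrC -x4 (exprD x 2 2) ler_wpM2r //.
by rewrite exprn_ge0 // ltW.
Unshelve. all: by end_near. Qed.

Lemma unit_primes_lower_bound (R : realType) :
  exists2 c : R, 0 < c & \forall m \near \oo,
    c * Num.sqrt m%:R <= #|unit_primes m|%:R * ln m%:R.
Proof.
have ln2 : 0 < ln 2 :> R by rewrite ln_gt0 // ltr1n.
exists (ln 2 / 8); first by rewrite divr_gt0.
near=> m.
(* Chosen so that the primes dividing [m], at most ln m / ln 2 of them, cost only a small part of
   the main term. *)
have L2 : 8 / ln 2 ^+ 2 * ln m%:R ^+ 2 <= Num.sqrt m%:R :> R.
  by near: m; exact: ln_sqr_le_sqrt.
set s := Num.sqrt m%:R in L2 *; set L := ln m%:R in L2 *; set k := #|_|%:R.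
have m16 : (16 <= m)%N by near: m; exists 16%N.
have s4 : 4 <= s.
  rewrite /s -[4]ger0_norm // -sqrtr_sqr ler_wsqrtr //.
  by rewrite -natrX ler_nat.
have s2 : s ^+ 2 = m%:R by rewrite sqr_sqrtr.
pose n := Num.trunc (s / 2).
have [n_le n_gt] : n%:R <= s / 2 /\ s / 2 < n%:R + 1.
  have /andP[-> /=] : n%:R <= s / 2 < n.+1%:R by rewrite truncn_itv //; lra.
  by rewrite natr1.
have n0 : (0 < n)%N by rewrite -(ltr0n R); lra.
have n2m : (n.*2 ^ 2 <= m)%N.
  rewrite -(ler_nat R) natrX -s2 ler_sqr ?nnegrE ?ler0n //; last by lra.
  by rewrite -mul2n natrM; lra.
have := size_primes_central_bin_leq n0 n2m.
have := exp2_size_primes_leq (leq_trans _ m16 : (0 < m)%N).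
have := leq_trans (exp2_leq_central_bin n) (central_bin_leq n0).
set a := size _; set b := size _ => exp_n exp_b.
rewrite -(ler_nat R) natrD -/k => ab.
have L0 : 0 < L by rewrite ln_gt0 // ltr1n (leq_trans _ m16).
have lnE (x y : nat) : (0 < x)%N -> ln ((x ^ y)%N%:R) = y%:R * ln x%:R :> R.
  by move=> x0; rewrite natrX lnXn ?ltr0n // mulr_natl.
(* The factor 1/2 comes from (2n)^2 <= m, that is, ln(2n) <= (ln m)/2. *)
have n_ln : n%:R * ln 2 <= a%:R * (L / 2).
  have : ln (2 ^ n)%N%:R <= ln (n.*2 ^ a)%N%:R :> R.
    by rewrite ler_ln ?posrE ?ltr0n ?expn_gt0 ?double_gt0 ?n0 // ler_nat.
  rewrite !lnE ?double_gt0 // => /le_trans; apply.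
  rewrite ler_wpM2l // ler_pdivlMr // mulrC mulr_natl -lnXn ?ltr0n ?double_gt0 //.
  by rewrite ler_ln ?posrE ?exprn_gt0 ?ltr0n ?double_gt0 -?natrX ?ler_nat //; lia.
have b_ln : b%:R * ln 2 <= L.
  have : ln (2 ^ b)%N%:R <= ln m%:R :> R.
    rewrite ler_ln ?posrE ?ltr0n ?expn_gt0 // ?ler_nat ?exp_b //; lia.
  by rewrite lnE.
have {}L2 : 8 * L ^+ 2 <= s * ln 2 ^+ 2.
  by rewrite -ler_pdivrMr ?exprn_gt0 // mulrAC.
have bL : 8 * (b%:R * L) <= s * ln 2.
  rewrite -(ler_pM2r ln2) -[leRHS]mulrA -expr2; apply: le_trans L2.
  have := ler_wpM2r (ltW L0) b_ln; rewrite expr2; lra.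
(* Here n > s/2 - 1 >= s/4, because s >= 4. *)
have aL : s * ln 2 <= 2 * (a%:R * L).
  have : s / 4 * ln 2 <= n%:R * ln 2 by rewrite ler_wpM2r ?(ltW ln2) //; lra.
  by move: n_ln; lra.
have abL : a%:R * L <= (k + b%:R) * L by rewrite ler_wpM2r ?(ltW L0).
(* Combining, s ln 2 / 2 <= a L <= k L + b L <= k L + s ln 2 / 8, which leaves more than the claimed
   s ln 2 / 8. *)
have := mulr_gt0 (lt_le_trans (ltr0n R 4) s4) ln2.
by move: abL aL bL; rewrite mulrDl; lra.
Unshelve. all: by end_near. Qed.

(** * Assembling the asymptotic estimate *)

Theorem theorem6 (R : realType) :
  exists C : R, forall Delta : nat -> R,
    Delta m @[m --> \oo] --> +oo ->
    \forall m \near \oo, forall S : int,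
      `| #|prime_mul_residues m S (interval_length (Delta m) m)|%:R - m%:R |
        <= C * (Delta m)^-1 * m%:R.
Proof.
have [c c0 card_ge] := unit_primes_lower_bound R.
(* 14/c and 8 are the constants that [h1] and [h2] produce from the two terms of the missed-class
   bound. *)
exists (14 / c + 8) => Delta /cvgryPge Delta_oo.
near=> m => S.
have m3 : (3 <= m)%N by near: m; exists 3%N.
have D1 : 1 <= Delta m by near: m; exact: Delta_oo.
have m_ge : expR 1 <= m%:R :> R by near: m; exact: nbhs_infty_ger.
have kL : c * Num.sqrt m%:R <= #|unit_primes m|%:R * ln m%:R by near: m.
set k := unit_primes m in kL *; set D := Delta m in D1 *.
pose L : R := ln m%:R; pose s : R := Num.sqrt m%:R; rewrite -/L -/s in kL.
have m0 : (0 < m)%N by apply: leq_trans m3.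
have mR : 0 < m%:R :> R by rewrite ltr0n.
have L1 : 1 <= L by rewrite -(expRK 1) ler_ln ?posrE ?expR_gt0.
have s1 : 1 <= s by rewrite -[leLHS]sqrtr1 ler_wsqrtr // ler1n.
have s2 : s ^+ 2 = m%:R by rewrite sqr_sqrtr // ltW.
have k0 : (0 < #|k|)%N.
  rewrite -(ltr0n R) -(pmulr_lgt0 _ (lt_le_trans ltr01 L1)).
  by apply: lt_le_trans kL; rewrite mulr_gt0 // (lt_le_trans ltr01).
(* Since phi(m) <= m, the interval has length at least D s L. *)
have phi1 : 1 <= Num.sqrt (m%:R / (totient m)%:R) :> R.
  rewrite -[leLHS]sqrtr1 ler_wsqrtr // ler_pdivlMr ?ltr0n ?totient_gt0 //.
  rewrite mul1r ler_nat.
  rewrite totient_count_coprime -[leqRHS]subn0 -[leqRHS]muln1 -sum_nat_const_nat.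
  by apply: leq_sum => i _; apply: leq_b1.
pose Y := interval_length D m; pose N := Num.trunc Y.
have DsL : 1 <= D * s * L by rewrite !mulr_ege1.
have Y_ge : D * s * L <= Y.
  rewrite /Y /interval_length -/L ler_wpM2r ?(le_trans ler01) //.
  by rewrite ler_peMr // ?mulr_ge0 ?(le_trans ler01).
have Y1 : 1 <= Y by apply: le_trans DsL Y_ge.
have [NY YN] : N%:R <= Y /\ Y < N%:R + 1.
  have /andP[-> /=] : N%:R <= Y < N.+1%:R by rewrite truncn_itv //; lra.
  by rewrite natr1.
have N1 : (0 < N)%N by rewrite truncn_gt0.
(* As N >= 1, rounding down costs at most a factor 2: Y < N + 1 <= 2N. *)
have N_ge : D * s * L <= 2 * N%:R.
  by have : 1 <= N%:R :> R by [rewrite ler1n]; lra.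
rewrite distrC ger0_norm; last first.
  by rewrite subr_ge0 ler_nat -[leqRHS]card_ord max_card.
apply: le_trans (missing_residues_le S m0 N1 k0 NY) _; rewrite -/k.
have kR : 0 < #|k|%:R :> R by rewrite ltr0n.
have NR : 0 < N%:R :> R by rewrite ltr0n.
have D0 : 0 < D := lt_le_trans ltr01 D1.
have s0 : 0 < s := lt_le_trans ltr01 s1.
(* Multiply [N_ge] by |Q| and the prime count [kL] by D s, with s^2 = m. *)
have kN_ge : c * D * m%:R <= 2 * (#|k|%:R * N%:R).
  have := ler_wpM2l (ltW kR) N_ge; have := ler_wpM2r (ltW (mulr_gt0 D0 s0)) kL.
  rewrite -s2; lra.
(* Square [N_ge] and use D >= 1 and L >= 1. *)
have N2_ge : D * m%:R <= 4 * N%:R ^+ 2.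
  have -> : 4 * N%:R ^+ 2 = (2 * N%:R) ^+ 2 :> R by ring.
  apply: (@le_trans _ _ ((D * s * L) ^+ 2)); last first.
    by rewrite ler_sqr ?nnegrE // ?mulr_ge0 // (le_trans ler01).
  rewrite !exprMn s2 -mulrA [m%:R * _]mulrC mulrA ler_wpM2r ?(ltW mR) //.
  by rewrite expr2 -mulrA ler_peMr ?(ltW D0) // mulr_ege1 // exprn_ege1.
have h1 : 7 / (#|k|%:R * N%:R) <= 14 / (c * D * m%:R).
  rewrite ler_pdivrMr ?mulr_gt0 // mulrAC ler_pdivlMr ?mulr_gt0 //; lra.
have h2 : 2 / N%:R ^+ 2 <= 8 / (D * m%:R).
  rewrite ler_pdivrMr ?exprn_gt0 // mulrAC ler_pdivlMr ?mulr_gt0 //; lra.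
apply: le_trans (ler_wpM2l (sqr_ge0 _) (lerD h1 h2)) _.
by rewrite le_eqVlt; apply/orP; left; apply/eqP; field; rewrite !gt_eqF.
Unshelve. all: by end_near. Qed.
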